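(* Assume that $X$ and $Y$ are Banach spaces such that $(X,Y)$ has the $\mu$-Lipschitz representation property for some $\mu\ge 1$. Then $(CL(X,Y),\|\ \|_{CL})$ is a Banach space.
   Context: For a map $f:X\to Y$ between Banach spaces, set $Lip_s(f)=\sup\{\|f(x)-f(x')\|/\|x-x'\| : \|x-x'\|\ge s\}$ for $s>0$ and $Lip_\infty(f)=\inf_{s>0}Lip_s(f)$; $f$ is coarse Lipschitz if $Lip_\infty(f)<\infty$. The set $\mathcal{CL}(X,Y)$ of coarse Lipschitz maps is a vector space on which $Lip_\infty$ is a semi-norm. With $\mathcal N(X,Y)=\{f\in\mathcal{CL}(X,Y): Lip_\infty(f)=0\}$, $CL(X,Y)$ is the quotient space $\mathcal{CL}(X,Y)/\mathcal N(X,Y)$, equipped with the norm $\|\ \|_{CL}$ induced by $Lip_\infty$. $Lip_0(X,Y)$ is the space of Lipschitz functions from $X$ to $Y$ vanishing at $0$, and $Lip(g)$ is the Lipschitz constant of $g$. For $\mu\ge1$, the pair $(X,Y)$ has the $\mu$-Lipschitz representation property ($\mu$-LRP) if for any $f\in\mathcal{CL}(X,Y)$ and any $c>Lip_\infty(f)$ there exists $g\in Lip_0(X,Y)$ such that $Lip(g)<\mu c$ and $f-g$ is bounded. *)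

(* Defs.v *)
From HB Require Import structures.
From mathcomp Require Import all_boot all_order all_algebra.
From mathcomp Require Import generic_quotient ring_quotient.
From mathcomp Require Import all_classical all_reals all_analysis.

Set Implicit Arguments.
Unset Strict Implicit.
Unset Printing Implicit Defensive.

Import Order.TTheory GRing.Theory Num.Theory.
Import numFieldNormedType.Exports.

Local Open Scope classical_set_scope.
Local Open Scope ring_scope.
Local Open Scope quotient_scope.

Section LipschitzConstants.
Context {R : realType} {X Y : normedModType R}.
Implicit Types (f g : X -> Y) (s c : R).

Definition slope f (p : X * X) : \bar R :=
  (`|f p.1 - f p.2| / `|p.1 - p.2|)%:E.

(* Suprema are taken in [0, +oo], so that the supremum of an empty family of
   slopes is 0 (this only matters when X = {0}); ereal_sup set0 would be -oo. *)
Definition Lip_s s f : \bar R :=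
  ereal_sup (0%E |` [set slope f p | p in [set p | s <= `|p.1 - p.2|]]).

Definition Lip_infty f : \bar R :=
  ereal_inf [set Lip_s s f | s in [set s | 0 < s]].

Definition coarse_lipschitz f : Prop := (Lip_infty f < +oo)%E.

Definition Lip f : \bar R :=
  ereal_sup (0%E |` [set slope f p | p in [set p | p.1 != p.2]]).

Definition Lip0 : set (X -> Y) :=
  [set g | [lipschitz g x | x in setT] /\ g 0 = 0].

Lemma Lip_infty_ge0 f : (0 <= Lip_infty f)%E.
Proof.
by apply: le_ereal_inf_tmp => _ [s _ <-]; apply: ereal_sup_ubound; left.
Qed.

Lemma Lip_infty_fin f : coarse_lipschitz f ->
  (fine (Lip_infty f))%:E = Lip_infty f.
Proof. by move=> fc; rewrite fineK// ge0_fin_numE// Lip_infty_ge0. Qed.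

Lemma Lip_infty_ltP f c : (Lip_infty f < c%:E)%E ->
  exists2 s, 0 < s &
    forall x x', s <= `|x - x'| -> `|f x - f x'| <= c * `|x - x'|.
Proof.
move=> /ereal_inf_lt[_ [s /= s0 <-] fc]; exists s => // x x' sx.
have xx0 : 0 < `|x - x'| by rewrite (lt_le_trans s0).
rewrite -ler_pdivrMr// -lee_fin (le_trans _ (ltW fc))//.
by apply: ereal_sup_ubound; right; exists (x, x').
Qed.

Lemma Lip_infty_le f s c : 0 < s -> 0 <= c ->
  (forall x x', s <= `|x - x'| -> `|f x - f x'| <= c * `|x - x'|) ->
  (Lip_infty f <= c%:E)%E.
Proof.
move=> s0 c0 fc; apply: (@le_trans _ _ (Lip_s s f)).
  by apply: ereal_inf_lbound; exists s.
apply: ge_ereal_sup => _ [->|[[x x'] /= sx <-]]; first by rewrite lee_fin.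
rewrite lee_fin ler_pdivrMr; first exact: fc.
by rewrite (lt_le_trans s0).
Qed.

Lemma Lip_infty0 : Lip_infty (0 : X -> Y) = 0%E.
Proof.
apply/eqP; rewrite eq_le Lip_infty_ge0 andbT.
by apply: (@Lip_infty_le _ 1) => // x x' _; rewrite subrr normr0 mul0r.
Qed.

Lemma Lip_inftyD f g :
  (Lip_infty (f + g)%R <= Lip_infty f + Lip_infty g)%E.
Proof.
have := Lip_infty_ge0 f; have := Lip_infty_ge0 g.
case Ef : (Lip_infty f) => [a| |]//; last first.
  by case: (Lip_infty g) => [b| |]// _ _; exact: leey.
case Eg : (Lip_infty g) => [b| |]//; last by move=> _ _; exact: leey.
rewrite !lee_fin => b0 a0; apply/lee_addgt0Pr => e e0.
have e20 : 0 < e / 2 by rewrite divr_gt0.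
have /Lip_infty_ltP[s s0 fs] : (Lip_infty f < (a + e / 2)%:E)%E.
  by rewrite Ef lte_fin ltrDl.
have /Lip_infty_ltP[t t0 gt] : (Lip_infty g < (b + e / 2)%:E)%E.
  by rewrite Eg lte_fin ltrDl.
rewrite -!EFinD; apply: (@Lip_infty_le _ (Num.max s t)).
- by rewrite lt_max s0.
- by rewrite addr_ge0 ?addr_ge0// ltW.
move=> x x'; rewrite ge_max => /andP[sx tx].
have -> : a + b + e = (a + e / 2) + (b + e / 2) by rewrite addrACA -splitr.
rewrite mulrDl (le_trans _ (lerD (fs _ _ sx) (gt _ _ tx)))//.
by rewrite (le_trans _ (ler_normD _ _))// !fctE opprD addrACA.
Qed.

Lemma Lip_inftyZ (a : R) f : Lip_infty (a *: f) = (`|a|%:E * Lip_infty f)%E.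
Proof.
have le_lip (b : R) (h : X -> Y) : b != 0 ->
    (Lip_infty (b *: h) <= `|b|%:E * Lip_infty h)%E.
  move=> b0; have nb0 : 0 < `|b| by rewrite normr_gt0.
  have := Lip_infty_ge0 h; case Eh : (Lip_infty h) => [u| |]//.
    rewrite lee_fin => u0; apply/lee_addgt0Pr => e e0.
    have ? : 0 < e / `|b| by rewrite divr_gt0.
    have /Lip_infty_ltP[s s0 hs] : (Lip_infty h < (u + e / `|b|)%:E)%E.
      by rewrite Eh lte_fin ltrDl.
    rewrite -EFinM -EFinD; apply: (Lip_infty_le s0).
      by rewrite addr_ge0 ?mulr_ge0// ltW.
    move=> x x' sx; rewrite !fctE -scalerBr normrZ.
    have -> : `|b| * u + e = `|b| * (u + e / `|b|).
      by rewrite mulrDr mulrCA divff ?gt_eqF// mulr1.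
    by rewrite -mulrA ler_pM2l// hs.
  by move=> _; rewrite gt0_muley ?lte_fin// leey.
have [->|a0] := eqVneq a 0; first by rewrite scale0r Lip_infty0 normr0 mul0e.
apply/eqP; rewrite eq_le le_lip//=.
have na0 : 0 < `|a| by rewrite normr_gt0.
rewrite -[X in (_ * Lip_infty X)%E](scalerK a0).
apply: (@le_trans _ _ (`|a|%:E * (`|a^-1|%:E * Lip_infty (a *: f)))%E).
  by rewrite lee_pmul2l ?lte_fin// le_lip// invr_eq0.
by rewrite muleA -EFinM -normrM divff// normr1 mul1e.
Qed.

Definition coarse_lip_pred : {pred X -> Y} :=
  fun f => `[< coarse_lipschitz f >].

Lemma coarse_lip_submod : submod_closed coarse_lip_pred.
Proof.
split; first by apply/asboolP; rewrite /coarse_lipschitz Lip_infty0.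
move=> a f g /asboolP fc /asboolP gc; apply/asboolP.
apply: le_lt_trans (Lip_inftyD _ _) _; rewrite lte_add_pinfty//.
by rewrite Lip_inftyZ -Lip_infty_fin// -EFinM ltry.
Qed.

HB.instance Definition _ := GRing.isSubmodClosed.Build R (X -> Y)
  coarse_lip_pred coarse_lip_submod.

End LipschitzConstants.

Definition LRP {R : realType} (mu : R) (X Y : normedModType R) : Prop :=
  forall (f : X -> Y) (c : R), coarse_lipschitz f -> (Lip_infty f < c%:E)%E ->
  exists g : X -> Y, [/\ Lip0 g, (Lip g < (mu * c)%:E)%E & bounded_fun (f - g)].

Section CoarseLipschitzMaps.
Context {R : realType}.
Variables X Y : normedModType R.

Record CLmap := MkCLmap {
  CLmap_val :> X -> Y;
  CLmap_valP : CLmap_val \in @coarse_lip_pred R X Y }.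

HB.instance Definition _ := [isSub for CLmap_val].
HB.instance Definition _ := [Choice of CLmap by <:].
HB.instance Definition _ := [SubChoice_isSubLmodule of CLmap by <:].

Definition CLnull : {pred CLmap} := fun f => Lip_infty f == 0%E.

Lemma CLmap_fin (f : CLmap) : (fine (Lip_infty f))%:E = Lip_infty f.
Proof. by apply: Lip_infty_fin; apply/asboolP/CLmap_valP. Qed.

Lemma CLnull_submod : submod_closed CLnull.
Proof.
split; first by rewrite unfold_in /= Lip_infty0.
move=> a f g; rewrite !unfold_in => /eqP f0 /eqP g0.
rewrite eq_le Lip_infty_ge0 andbT (le_trans (Lip_inftyD _ _))//.
by rewrite Lip_inftyZ f0 g0 mule0 adde0.
Qed.

HB.instance Definition _ :=
  GRing.isSubmodClosed.Build R CLmap CLnull CLnull_submod.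

Definition CL : Type := Quotient.quot CLnull.

HB.instance Definition _ := GRing.Zmodule.on CL.
HB.instance Definition _ := EqQuotient.on CL.

Lemma pi_CLD (f g : CLmap) : \pi_CL (f + g) = \pi_CL f + \pi_CL g.
Proof. exact: (@pi_addr _ _ _ _ _ (Quotient.quot CLnull)). Qed.

Lemma pi_CL_eq (f g : CLmap) :
  (\pi_CL f == \pi_CL g) = (Lip_infty (f - g) == 0%E).
Proof. by rewrite -(@Quotient.idealrBE _ CLnull). Qed.

Definition CL_scale (a : R) : CL -> CL := lift_op1 CL ( *:%R a).

Lemma pi_CL_scale a (f : CLmap) : \pi_CL (a *: f) = CL_scale a (\pi_CL f).
Proof.
unlock CL_scale; apply/eqP; rewrite pi_CL_eq -scalerBr Lip_inftyZ.
have := reprK (\pi_CL f) => /eqP; rewrite eq_sym pi_CL_eq => /eqP ->.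
by rewrite mule0.
Qed.

Fact CL_scaleA a b u : CL_scale a (CL_scale b u) = CL_scale (a * b) u.
Proof. by rewrite -[u]reprK -!pi_CL_scale scalerA. Qed.

Fact CL_scale1 : left_id 1 CL_scale.
Proof. by move=> u; rewrite -[u]reprK -pi_CL_scale scale1r. Qed.

Fact CL_scaleDr : right_distributive CL_scale +%R.
Proof.
move=> a u v; rewrite -[u]reprK -[v]reprK.
by rewrite -pi_CLD -!pi_CL_scale -pi_CLD scalerDr.
Qed.

Fact CL_scaleDl u : {morph CL_scale^~ u : a b / a + b}.
Proof.
by move=> a b; rewrite -[u]reprK -!pi_CL_scale -pi_CLD scalerDl.
Qed.

HB.instance Definition _ := GRing.Zmodule_isLmodule.Build R CL
  CL_scaleA CL_scale1 CL_scaleDr CL_scaleDl.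

Definition CL_norm : CL -> R :=
  lift_fun1 CL (fun f : CLmap => fine (Lip_infty f)).

Lemma pi_CL_norm (f : CLmap) : CL_norm (\pi_CL f) = fine (Lip_infty f).
Proof.
unlock CL_norm; congr fine.
have le_lip (g h : CLmap) : \pi_CL g = \pi_CL h ->
    (Lip_infty g <= Lip_infty h)%E.
  move=> /eqP; rewrite pi_CL_eq => /eqP gh0.
  have -> : (g : X -> Y) = (g - h : CLmap) + h :> (X -> Y).
    by rewrite -[in LHS](subrK h g).
  by rewrite (le_trans (Lip_inftyD _ _))// gh0 add0e.
by apply/eqP; rewrite eq_le !le_lip ?reprK.
Qed.

Fact CL_ler_normD u v : CL_norm (u + v) <= CL_norm u + CL_norm v.
Proof.
rewrite -[u]reprK -[v]reprK -pi_CLD !pi_CL_norm -lee_fin EFinD !CLmap_fin.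
exact: Lip_inftyD.
Qed.

Fact CL_normZ a u : CL_norm (a *: u) = `|a| * CL_norm u.
Proof.
rewrite -[u]reprK -[a *: _]pi_CL_scale !pi_CL_norm; apply: EFin_inj.
by rewrite EFinM !CLmap_fin -Lip_inftyZ.
Qed.

Fact CL_norm0_eq0 u : CL_norm u = 0 -> u = 0.
Proof.
rewrite -[u]reprK pi_CL_norm => u0.
have <- : \pi_CL 0 = 0 :> CL.
  exact: (@pi_zeror _ _ _ _ _ (Quotient.quot CLnull)).
by apply/eqP; rewrite pi_CL_eq subr0 -CLmap_fin u0.
Qed.

HB.instance Definition _ := Lmodule_isNormed.Build R CL
  CL_ler_normD CL_normZ CL_norm0_eq0.

Lemma CL_normE (f : CLmap) : (`|\pi_CL f|%:E = Lip_infty f)%E.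
Proof. by rewrite -CLmap_fin; congr EFin; exact: pi_CL_norm. Qed.

Lemma pi_CLZ a (f : CLmap) : \pi_CL (a *: f) = a *: \pi_CL f.
Proof. exact: pi_CL_scale. Qed.

End CoarseLipschitzMaps.

(* The condition is the cauchy_cvg axiom of completeType, here for the
   uniformity induced by the norm of V. *)
Definition Banach {R : realType} (V : normedModType R) : Prop :=
  forall F : set_system V, ProperFilter F -> cauchy F -> cvg F.

(* Main.v *)
Require Import Defs.
From HB Require Import structures.
From mathcomp Require Import all_boot all_order all_algebra.
From mathcomp Require Import all_classical all_reals all_analysis.
From mathcomp Require Import ring lra.
Import Order.TTheory GRing.Theory Num.Theory.
Import numFieldNormedType.Exports.
Local Open Scope ring_scope.
Local Open Scope classical_set_scope.
Local Open Scope quotient_scope.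

(** Completeness of CL(X,Y) reduces to the convergence of the
    sequences of classes whose n-th step has norm at most 2^-n
    ([Banach_geometric_steps]). Take representatives f_n of such a sequence.
    Their steps f_(n+1) - f_n are only controlled at large distances, at a
    scale that may grow with n, so there is no reason for the f_n to converge
    pointwise. The representation property repairs this: it replaces
    f_(n+1) - f_n, up to a bounded map, by a map g_n vanishing at 0 whose
    Lipschitz constant is less than 2 mu 2^-n. Bounded maps have Lip_infty 0
    ([Lip_infty_bounded]), so the class of the step does not change
    ([LRP_modulo_null]).

    Now |g_n x| <= 2 mu 2^-n |x|, hence the series of the g_n converges
    pointwise in the complete space Y, to a map G whose distance to the n-th
    partial sum is O(2^-n) in Lipschitz constant ([Lip_infty_series]). As f_n
    and f_0 + sum_(k < n) g_k have the same class, the classes of the f_n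
    converge to the class of f_0 + G. *)

Lemma exp2VS {R : realType} n : 2 ^- n.+1 = 2 ^- n / 2 :> R.
Proof. by rewrite exprSr invfM mulrC. Qed.

(** Sum the geometric series of the steps between n and m; its tail from n
    on is twice its first term. *)
Lemma dist_geometric {R : realType} {V : normedModType R} {v : nat -> V}
    {C : R} :
  (forall n, `|v n.+1 - v n| <= C * 2 ^- n) ->
  forall n m, (n <= m)%N -> `|v m - v n| <= C * 2 * 2 ^- n.
Proof.
move=> vC n m /subnKC <-.
have C0 : 0 <= C by have := vC 0%N; rewrite expr0 invr1 mulr1; apply: le_trans.
have p0 k : 0 < 2 ^- k :> R by rewrite invr_gt0 exprn_gt0.
(* The subtracted term makes the bound provable by induction on k. *)
suff vnk k : `|v (n + k)%N - v n| <= C * 2 * (2 ^- n - 2 ^- (n + k)).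
  apply: le_trans (vnk _) _; rewrite ler_wpM2l ?mulr_ge0// lerBlDr lerDl.
  exact: ltW.
elim: k => [|k IH]; first by rewrite addn0 !subrr normr0 mulr0.
rewrite -(subrKA (v (n + k)%N)) addnS (le_trans (ler_normD _ _))//.
apply: le_trans (lerD (vC _) IH) _; rewrite exp2VS; lra.
Qed.

Lemma dist_lim_geometric {R : realType} {V : normedModType R} {v : nat -> V}
    {l : V} {C : R} :
  (forall n, `|v n.+1 - v n| <= C * 2 ^- n) -> v @ \oo --> l ->
  forall n, `|l - v n| <= C * 2 * 2 ^- n.
Proof.
move=> vC vl n.
have vlim : `|v m - v n| @[m --> \oo] --> `|l - v n|.
  by apply: cvg_norm; apply: cvgB => //; exact: cvg_cst.
rewrite -(cvg_lim _ vlim)//; apply: limr_le.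
  by apply/cvg_ex; eexists; exact: vlim.
by near=> m; apply: dist_geometric => //; near: m; exact: nbhs_infty_ge.
Unshelve. all: by end_near. Qed.

Lemma near_exp2V_lt {R : realType} (C : R) {e : R} : 0 < e ->
  \forall n \near \oo, C * 2 ^- n < e.
Proof.
move=> e0; have C1 : 0 < `|C| + 1 by rewrite ltr_wpDl.
near=> n.
apply: (@le_lt_trans _ _ ((`|C| + 1) * 2 ^- n)).
  by rewrite ler_wpM2r// (le_trans (ler_norm C))// lerDl.
rewrite -ltr_pdivlMl// mulrC -div1r; near: n.
by apply: near_infty_natSinv_expn_lt (PosNum (divr_gt0 e0 C1)).
Unshelve. all: by end_near. Qed.

Lemma cvgn_geometric_steps {R : realType} {V : completeNormedModType R}
    {v : nat -> V} {C : R} :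
  (forall n, `|v n.+1 - v n| <= C * 2 ^- n) -> cvgn v.
Proof.
move=> vC; apply: cauchy_cvg; apply: cauchy_exP => e e0.
have [n /= ne] := filter_ex (near_exp2V_lt (C * 2) e0).
exists (v n); near=> m; rewrite -ball_normE /ball_ /= distrC.
apply: le_lt_trans (dist_geometric vC _ _ _) ne.
by near: m; exact: nbhs_infty_ge.
Unshelve. all: by end_near. Qed.

(** A Cauchy filter contains balls of radius 2^-n / 2 for all n. Two such
    balls always meet, so their centres form a sequence with geometric steps;
    the filter converges to the limit of this sequence. *)
Lemma Banach_geometric_steps {R : realType} (V : normedModType R) :
  (forall u : nat -> V, (forall n, `|u n.+1 - u n| <= 2 ^- n) -> cvgn u) ->
  Banach V.
Proof.
move=> Vcvg F FF Fcauchy.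
have p0 k : 0 < 2 ^- k :> R by rewrite invr_gt0 exprn_gt0.
have /choice[u Fu] n : exists x, F (ball x (2 ^- n / 2)).
  by apply: (cauchyP F).1 => //; rewrite divr_gt0.
have uV n : `|u n.+1 - u n| <= 2 ^- n.
  have [x []] := filter_ex (filterI (Fu n) (Fu n.+1)).
  rewrite -ball_normE /ball_ /= => ux u1x.
  rewrite -(subrKA x) (le_trans (ler_normD _ _))// [X in _ + X]distrC.
  by rewrite exp2VS in u1x; have := p0 n; lra.
have /cvg_ex[l ul] := Vcvg u uV; apply/cvg_ex; exists l.
apply/cvgrPdist_lt => e e0; have e2 : 0 < e / 2 by rewrite divr_gt0.
have [n [ln ne]] : exists n, `|l - u n| < e / 2 /\ 1 * 2 ^- n < e.
  apply: (@filter_ex _ \oo); apply: filterI; last exact: near_exp2V_lt.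
  by move/cvgrPdist_lt : ul; apply.
apply: filterS (Fu n) => x; rewrite -ball_normE /ball_ /= => unx.
rewrite -(subrKA (u n)) (le_lt_trans (ler_normD _ _))//; lra.
Qed.

Section LipInfty.
Context {R : realType} {X Y : normedModType R}.
Implicit Types (f : X -> Y).

(** If |f| <= M, then |f x - f x'| <= 2 M, which is at most e |x - x'| as
    soon as |x - x'| >= 2 M / e. *)
Lemma Lip_infty_bounded f : bounded_fun f -> Lip_infty f = 0%E.
Proof.
move=> /pinfty_ex_gt0[M M0 fM]; apply/eqP; rewrite eq_le Lip_infty_ge0 andbT.
apply/lee_addgt0Pr => e e0; rewrite add0e.
have s0 : 0 < 2 * M / e + 1 by rewrite ltr_wpDl// divr_ge0 ?mulr_ge0 ?ltW.
apply: (Lip_infty_le s0); first exact: ltW.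
move=> x x' sx; apply: (@le_trans _ _ (2 * M)).
  by rewrite (le_trans (ler_normB _ _))// mulr_natl mulr2n lerD//; exact: fM.
rewrite [leRHS]mulrC -ler_pdivrMr//; apply: le_trans sx; lra.
Qed.

Lemma Lip_inftyN f : Lip_infty (- f) = Lip_infty f.
Proof. by rewrite -scaleN1r Lip_inftyZ normrN1 mul1e. Qed.

Lemma Lip_infty_lipschitz f c : 0 <= c ->
  (forall x x', `|f x - f x'| <= c * `|x - x'|) -> (Lip_infty f <= c%:E)%E.
Proof. by move=> c0 fc; apply: (Lip_infty_le (s := 1)) => // x x' _. Qed.

Lemma lipschitz_Lip_lt f c : (Lip f < c%:E)%E ->
  forall x x', `|f x - f x'| <= c * `|x - x'|.
Proof.
move=> fc x x'; have [->|xx'] := eqVneq x x'.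
  by rewrite !subrr !normr0 mulr0.
rewrite -ler_pdivrMr ?normr_gt0 ?subr_eq0// -lee_fin (le_trans _ (ltW fc))//.
by apply: ereal_sup_ubound; right; exists (x, x').
Qed.

End LipInfty.

(** The form in which the representation property is used: what matters about
    the bounded difference is only that it vanishes in CL(X,Y). *)
Lemma LRP_modulo_null {R : realType} {mu : R} {X Y : normedModType R}
    {f : X -> Y} {c : R} : LRP mu X Y -> (Lip_infty f < c%:E)%E ->
  exists g : X -> Y,
    [/\ g 0 = 0, forall x x', `|g x - g x'| <= mu * c * `|x - x'| &
        Lip_infty (f - g) = 0%E].
Proof.
move=> lrp fc; have fCL : coarse_lipschitz f by apply: lt_trans fc (ltry _).
have [g [[_ g0] /lipschitz_Lip_lt gL gb]] := lrp f c fCL fc.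
by exists g; split=> //; exact: Lip_infty_bounded.
Qed.

(** The increments of the partial sums between x and x' have geometric steps
    proportional to |x - x'|, so the tail estimate passes to the limit as a
    Lipschitz bound. Taking x' = 0 yields the pointwise convergence. *)
Lemma Lip_infty_series {R : realType} {X : normedModType R}
    {Y : completeNormedModType R} {g : nat -> X -> Y} {c : R} : 0 <= c ->
  (forall n, g n 0 = 0) ->
  (forall n x x', `|g n x - g n x'| <= c * 2 ^- n * `|x - x'|) ->
  exists G : X -> Y, forall n,
    (Lip_infty (G - \sum_(k < n) g k)%R <= (c * 2 * 2 ^- n)%:E)%E.
Proof.
move=> c0 g0 gL; pose S n := \sum_(k < n) g k.
have SS n x : S n.+1 x - S n x = g n x.
  by rewrite /S big_ord_recr/= !fctE addrC addrA addNr add0r.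
have Scvg x : cvgn (S ^~ x).
  apply: (@cvgn_geometric_steps _ _ _ (c * `|x|)) => n.
  by rewrite SS -[g n x]subr0 -(g0 n) mulrAC -[in leRHS](subr0 x).
exists (fun x => limn (S ^~ x)) => n.
apply: Lip_infty_lipschitz => [|x x'].
  by rewrite !mulr_ge0// invr_ge0 exprn_ge0.
have dvL k : `|(S k.+1 x - S k.+1 x') - (S k x - S k x')| <=
    c * `|x - x'| * 2 ^- k.
  by rewrite opprD addrACA -opprD !SS mulrAC.
have Sxx' : S k x - S k x' @[k --> \oo] --> limn (S ^~ x) - limn (S ^~ x').
  by apply: cvgB; exact: Scvg.
have := dist_lim_geometric dvL Sxx' n.
rewrite opprD addrACA -opprD => /le_trans; apply; lra.
Qed.

Lemma pi_CLB {R : realType} {X Y : normedModType R} (f g : CLmap X Y) :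
  \pi_(CL X Y) (f - g) = \pi_(CL X Y) f - \pi_(CL X Y) g.
Proof. by rewrite -scaleN1r pi_CLD pi_CLZ scaleN1r. Qed.

Theorem proposition4p5 (R : realType) (X Y : completeNormedModType R)
  (hLRP : exists2 mu : R, 1 <= mu & LRP mu X Y) :
  Banach (CL X Y).
Proof.
case: hLRP => mu mu1 lrp; have mu0 : 0 <= mu by exact: le_trans mu1.
apply: Banach_geometric_steps => u uV; pose f n : CLmap X Y := repr (u n).
have uE n : u n = \pi_(CL X Y) (f n) by rewrite reprK.
(* The factor 2 makes the bound strict, as the representation property asks. *)
have fV n : (Lip_infty ((f n.+1 - f n)%R : CLmap X Y) < (2 * 2 ^- n)%:E)%E.
  rewrite -CL_normE lte_fin pi_CLB -!uE (le_lt_trans (uV n))//.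
  by rewrite ltr_pMl ?ltr1n// invr_gt0 exprn_gt0.
have /choice[g gP] n := LRP_modulo_null lrp (fV n).
have [|n|n x x'|G GP] := @Lip_infty_series _ X Y g (mu * 2).
- by rewrite mulr_ge0.
- by have [] := gP n.
- by have [_ + _] := gP n; rewrite mulrA.
have fS n : Lip_infty ((f n : X -> Y) - f 0%N - \sum_(k < n) g k) = 0%E.
  elim: n => [|n IH].
    by rewrite big_ord0 subrr subr0 Lip_infty0.
  have [_ _ gN] := gP n.
  have -> : (f n.+1 : X -> Y) - f 0%N - \sum_(k < n.+1) g k =
      (f n.+1 : X -> Y) - f n - g n +
      ((f n : X -> Y) - f 0%N - \sum_(k < n) g k).
    by rewrite big_ord_recr/= [RHS]addrACA subrKA -opprD [g n + _]addrC.
  apply/eqP; rewrite eq_le Lip_infty_ge0 andbT.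
  by rewrite (le_trans (Lip_inftyD _ _))// IH gN adde0.
have FfP n :
    (Lip_infty ((f 0%N : X -> Y) + G - f n)%R <= (mu * 2 * 2 * 2 ^- n)%:E)%E.
  have -> : (f 0%N : X -> Y) + G - f n = (G - \sum_(k < n) g k) -
     ((f n : X -> Y) - f 0%N - \sum_(k < n) g k).
    by rewrite opprB subrKA opprB addrCA addrA.
  rewrite (le_trans (Lip_inftyD _ _))// Lip_inftyN fS adde0.
  exact: GP.
have FP : (f 0%N : X -> Y) + G \in @coarse_lip_pred R X Y.
  apply/asboolP.
  have -> : (f 0%N : X -> Y) + G = (f 0%N : X -> Y) + G - f 0%N + f 0%N.
    by rewrite subrK.
  rewrite /coarse_lipschitz (le_lt_trans (Lip_inftyD _ _))// lte_add_pinfty//.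
    by rewrite (le_lt_trans (FfP 0%N)) ?ltry.
  exact/asboolP/CLmap_valP.
apply/cvg_ex; exists (\pi_(CL X Y) (MkCLmap FP)).
apply/cvgrPdist_lt => e e0; near=> n.
rewrite uE -pi_CLB -lte_fin CL_normE (le_lt_trans (FfP n))// lte_fin.
by near: n; exact: near_exp2V_lt.
Unshelve. all: by end_near. Qed.
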